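(* For all integers $m\ge k\ge 4$, $\mathrm{ESO}(m,k)\ge \lfloor k/2\rfloor\,(m-k+5)-3$.
   Context: For a point $p\in\mathbb{R}^2$ write $x(p),y(p)$ for its coordinates. A finite set of points with distinct $x$-coordinates, listed as $p_1,\dots,p_n$ with $x(p_1)<\dots<x(p_n)$, is an $n$-up-run if $y(p_i)\le y(p_{i+1})$ for all $1\le i\le n-1$, and an $n$-down-run if $y(p_i)>y(p_{i+1})$ for all $1\le i\le n-1$. The Erdős–Szekeres on-line game $A_{m,k}$ ($m,k\ge1$): in each turn, player A chooses a value $\hat x\in(0,1)$ and then player B chooses a value $\hat y\in(0,1)$, forming the point $(\hat x,\hat y)$. The game ends after the first turn at which the set of played points contains an $m$-up-run or a $k$-down-run. Player A aims to end the game in as few turns as possible, player B in as many as possible. $\mathrm{ESO}(m,k)$ denotes the number of turns the game $A_{m,k}$ lasts when both players play optimally. *)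

(* Defs.v *)
(* MathComp world; the plane is R * R for R : realType. *)
From HB Require Import structures.
From mathcomp Require Import all_boot all_order all_algebra.
From mathcomp Require Import boolp reals.
From mathcomp Require Import ring lra zify.
Set Implicit Arguments.
Unset Strict Implicit.
Unset Printing Implicit Defensive.
Import Order.TTheory GRing.Theory Num.Theory.
Local Open Scope ring_scope.

(* A run is given by the listing p_1, ..., p_n of its points by increasing
   abscissa; up-runs are weakly increasing, down-runs strictly decreasing. *)
Definition up_run (R : realType) (n : nat) (s : seq (R * R)) : Prop :=
  size s = n /\ sorted (fun p q : R * R => (p.1 < q.1) && (p.2 <= q.2)) s.

Definition down_run (R : realType) (n : nat) (s : seq (R * R)) : Prop :=
  size s = n /\ sorted (fun p q : R * R => (p.1 < q.1) && (p.2 > q.2)) s.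

(* P lists the points played so far; only its underlying set matters.  An
   abscissa may be played repeatedly, but two points with the same abscissa
   never belong to a common run. *)
Definition game_over (R : realType) (m k : nat) (P : seq (R * R)) : Prop :=
  (exists2 s, up_run m s & {subset s <= P}) \/
  (exists2 s, down_run k s & {subset s <= P}).

(* From position P, player A can force the game to end after at most t further
   turns, however B plays.  Its negation says, by the dual alternation of
   quantifiers, that B can make the game last more than t further turns. *)
Fixpoint A_ends_within (R : realType) (m k t : nat) (P : seq (R * R)) : Prop :=
  game_over m k P \/
  if t is t'.+1 then
    exists2 x : R, 0 < x < 1 &
      forall y : R, 0 < y < 1 -> A_ends_within m k t' ((x, y) :: P)
  else False.

Lemma game_over_large (R : realType) (m k : nat) (P : seq (R * R)) :
  sorted (fun p q : R * R => p.1 < q.1) P -> (m * k < size P)%N ->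
  game_over m k P.
Proof.
elim: m P => [|m IHm] P sP ltP; first by left; exists [::].
have tr : transitive (fun p q : R * R => p.1 < q.1).
  by move=> q p r; apply: lt_trans.
pose b (p : R * R) := has (fun q : R * R => (q.1 < p.1) && (q.2 <= p.2)) P.
have [leM|ltM] := leqP k (size (filter (predC b) P)).
  right; exists (take k (filter (predC b) P)); last first.
    by move=> p /mem_take; rewrite mem_filter => /andP[].
  split; first by rewrite size_takel.
  apply: take_sorted.
  have: sorted (fun p q : R * R => p.1 < q.1) (filter (predC b) P).
    exact: sorted_filter.
  apply: (@sub_in_sorted _ [in filter (predC b) P]); last exact/allP.
  move=> p q pM qM; have {}pM : p \in filter (predC b) P by [].
  have {}qM : q \in filter (predC b) P by [].
  move: pM qM; rewrite !mem_filter /=.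
  move=> /andP[_ pP] /andP[/hasPn nq _] pq.
  by have := nq p pP; rewrite pq /= -ltNge.
have : (m * k < size (filter b P))%N.
  have := count_predC b P; rewrite !size_filter in ltM *; lia.
move=> /(IHm _ (sorted_filter tr _ sP)) [[s [ss us] sub]|[s ds sub]]; last first.
  by right; exists s => // p /sub; rewrite mem_filter => /andP[].
left; case: s ss us sub => [|p s] ss us sub.
  case: P {IHm sP b ltM sub} ltP => // p P _.
  exists [:: p]; first by split => //; rewrite -ss.
  by move=> q; rewrite !inE => ->.
have := sub p (mem_head _ _); rewrite mem_filter => /andP[/hasP[q qP pq] _].
exists [:: q, p & s].
  by split; [rewrite /= -ss | rewrite /= pq].
move=> r; rewrite inE => /predU1P[-> //|/sub].
by rewrite mem_filter => /andP[].
Qed.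

Lemma A_ends_ex (R : realType) (m k : nat) :
  exists t, `[< A_ends_within m k t ([::] : seq (R * R)) >].
Proof.
exists (m * k).+1; apply/asboolP.
have H t (P : seq (R * R)) : sorted (fun p q : R * R => p.1 < q.1) P ->
    all (fun p : R * R => 0 < p.1 < 1) P -> (m * k < size P + t)%N ->
    A_ends_within m k t P.
  elim: t P => [|t IHt] P sP aP ltP /=.
    by left; apply: game_over_large => //; rewrite addn0 in ltP.
  right; case: P sP aP ltP => [|p P] sP aP ltP.
    exists (2^-1) => [|y _]; first lra.
    by apply: IHt => //=; rewrite andbT; lra.
  have p01 : 0 < p.1 < 1 by have /andP[] := aP.
  exists (p.1 / 2) => [|y _]; first lra.
  apply: IHt; rewrite /= in sP aP ltP *.
  - by rewrite sP andbT; lra.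
  - by rewrite aP andbT; lra.
  - lia.
by apply: H => //=; lia.
Qed.

(* The minimax length of the game: the least number of turns within which A can
   force it to end. *)
Definition ESO (R : realType) (m k : nat) : nat := ex_minn (A_ends_ex R m k).

(* Main.v *)
(** B plays on fewer than k fixed heights ("letters"), so that no k-down-run ever
    arises, and a position is the word of the letters in the order of the
    abscissas.  Let j = k %/ 2.  For j >= 3, B cuts the word into at most
    Q = m - 2 j + 5 cells and keeps the "inner" letters 1, ..., 2 j - 3 distinct
    within each cell, barring the lowest one from the first cell and the highest
    one from the last cell.  When the cell that A points at already contains all
    the inner letters it may contain, B cuts it in the middle, which makes one of
    these letters available again; so every cell but the current one retains
    about j - 1 letters.  Once there are Q cells, B also uses two outer letters,
    one below and one above.  An inner letter c in cell i (counted from 0) gets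
    the label i + c, the r-th bottom letter the label r + 1, and symmetrically for
    the top letters.  If bottom and top letters are rationed so that their labels
    do not interfere with the inner ones, labels increase strictly along up-runs;
    as there are m - 1 labels, there is no m-up-run.  For j = 2 the inner letter
    is simply played m - 1 times before the outer ones. *)
Require Import Defs.
From mathcomp Require Import all_boot all_order all_algebra reals.
From mathcomp Require Import boolp zify.
Set Implicit Arguments.
Unset Strict Implicit.
Unset Printing Implicit Defensive.
Import Order.TTheory GRing.Theory Num.Theory.

(** * From words of letters to positions of the game *)

Section Bands.
Local Open Scope ring_scope.
Variables (R : realType) (K : nat).

(** The successors keep the heights of the letters below [K] strictly between 0 and 1. *)
Definition band (z : R * nat) : R * R := (z.1, z.2.+1%:R / K.+1%:R).

Let K0 : (0 : R) < K.+1%:R. Proof. by rewrite ltr0n. Qed.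

Lemma band_le (z z' : R * nat) : ((band z).2 <= (band z').2) = (z.2 <= z'.2)%N.
Proof. by rewrite /= ler_pM2r ?invr_gt0 // ler_nat ltnS. Qed.

Lemma band_unit (z : R * nat) : (z.2 < K)%N -> 0 < (band z).2 < 1.
Proof.
move=> zK; rewrite /= divr_gt0 ?ltr0n //=.
by rewrite ltr_pdivrMr // mul1r ltr_nat ltnS.
Qed.

(** Both [s] and [Z] are strictly sorted by abscissa, so [s] is determined by its set of points and
    can be read off [Z] as a subsequence. The free [r] serves up-runs and down-runs alike. *)
Lemma run_lift (r : rel (R * R)) (Z : seq (R * nat)) (s : seq (R * R)) :
    sorted (fun z z' : R * nat => z.1 < z'.1) Z ->
    sorted (fun p q : R * R => (p.1 < q.1) && r p q) s ->
    {subset s <= map band Z} ->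
  exists2 s0, subseq s0 Z & map band s0 = s.
Proof.
move=> sZ ss sub; exists (filter (fun z => band z \in s) Z).
  exact: filter_subseq.
pose lt1 := fun p q : R * R => p.1 < q.1.
have tr : transitive (fun z z' : R * nat => z.1 < z'.1).
  by move=> b a c; apply: lt_trans.
apply: (@irr_sorted_eq _ lt1).
- by move=> b a c; apply: lt_trans.
- by move=> a; rewrite /lt1 ltxx.
- by rewrite sorted_map; apply: sorted_filter.
- by apply: sub_sorted ss => p q /andP[].
move=> p; apply/mapP/idP => [[z]|ps].
  by rewrite mem_filter => /andP[zs _] ->.
have /mapP[z zZ pz] := sub _ ps.
by exists z; rewrite // mem_filter -pz ps.
Qed.

End Bands.

(** Reduces the game to words: [W] is an invariant that B can maintain at every gap A may choose, up
    to length [N]. A down-run would need [k] distinct letters among only [K]; an up-run is a weakly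
    increasing subword. *)
Lemma survival (R : realType) (m k K N : nat) (W : seq nat -> Prop) :
    (K < k)%N -> W [::] ->
    (forall w, W w -> all (ltn^~ K) w) ->
    (forall w s, W w -> subseq s w -> sorted leq s -> (size s < m)%N) ->
    (forall u v, W (u ++ v) -> (size (u ++ v) < N)%N ->
       exists2 c, (c < K)%N & W (u ++ c :: v)) ->
  (N < ESO R m k)%N.
Proof.
move=> Kk W0 Wall Wup Wstep.
have over (Z : seq (R * nat)) (P : seq (R * R)) :
    sorted (fun z z' : R * nat => z.1 < z'.1)%R Z -> W (map snd Z) ->
    {subset P <= map (band K) Z} -> ~ game_over m k P.
  move=> sZ WZ PZ [] [s [szs ss] sP].
    have [s0 s0Z def_s] := run_lift sZ ss (fun p ps => PZ _ (sP _ ps)).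
    have : (size (map snd s0) < m)%N.
      apply: (Wup _ _ WZ (map_subseq _ s0Z)).
      move: ss; rewrite -def_s !sorted_map; apply: sub_sorted => z z' /=.
      by case/andP=> _; rewrite [X in is_true X -> _]band_le.
    by rewrite size_map -(size_map (band K)) def_s szs ltnn.
  have [s0 s0Z def_s] := run_lift sZ ss (fun p ps => PZ _ (sP _ ps)).
  have : sorted gtn (map snd s0).
    move: ss; rewrite -def_s !sorted_map; apply: sub_sorted => z z' /=.
    by case/andP=> _; rewrite ltNge [X in is_true (~~ X) -> _]band_le -ltnNge.
  move=> /(sorted_uniq (rev_trans ltn_trans) ltnn) un.
  have /(uniq_leq_size un) : {subset map snd s0 <= iota 0 K}.
    move=> c /(mem_subseq (map_subseq snd s0Z)) cZ.
    by rewrite mem_iota /= add0n; apply: (allP (Wall _ WZ)).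
  by rewrite size_iota size_map -(size_map (band K)) def_s szs leqNgt Kk.
(* [Z] holds the position sorted by abscissa and without repetitions. It is enough that [P] is
   contained in its image. *)
have surv t (Z : seq (R * nat)) (P : seq (R * R)) :
    sorted (fun z z' : R * nat => z.1 < z'.1)%R Z -> W (map snd Z) ->
    {subset P <= map (band K) Z} -> (size Z + t <= N)%N ->
    ~ A_ends_within m k t P.
  elim: t Z P => [|t IHt] Z P sZ WZ PZ szZ /= [].
  - exact: over WZ PZ.
  - by [].
  - exact: over WZ PZ.
  move=> [x x01 Ax].
  (* On an abscissa already played, B repeats the point of [Z] standing there, so [Z] stays the
     same. *)
  have [/mapP[z zZ xz]|xZ] := boolP (x \in map fst Z).
    have zK : (z.2 < K)%N by apply: (allP (Wall _ WZ)); apply: map_f.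
    apply: (IHt Z _ sZ WZ _ _ (Ax _ (band_unit zK))); last by lia.
    move=> p; rewrite inE => /predU1P[->|/PZ //].
    by rewrite xz; apply: (map_f (band K) zZ).
  pose Zl := filter (fun z : R * nat => z.1 < x)%R Z.
  pose Zr := filter (fun z : R * nat => x < z.1)%R Z.
  have tr : transitive (fun z z' : R * nat => z.1 < z'.1)%R.
    by move=> b a c; apply: lt_trans.
  have irr : irreflexive (fun z z' : R * nat => z.1 < z'.1)%R.
    by move=> a; rewrite ltxx.
  have sZl : sorted (fun z z' : R * nat => z.1 < z'.1)%R Zl by apply: sorted_filter.
  have sZr : sorted (fun z z' : R * nat => z.1 < z'.1)%R Zr by apply: sorted_filter.
  have sep (c : nat) : sorted (fun z z' : R * nat => z.1 < z'.1)%R (Zl ++ (x, c) :: Zr).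
    rewrite sorted_pairwise // pairwise_cat /= -!sorted_pairwise // sZl sZr andbT /=.
    apply/andP; split; last by apply/allP => z; rewrite mem_filter => /andP[].
    apply/allrelP => z z'; rewrite mem_filter inE => /andP[zx _].
    case/predU1P=> [-> //|]; rewrite mem_filter => /andP[xz' _].
    exact: lt_trans zx xz'.
  have defZ : Z = Zl ++ Zr.
    apply: (irr_sorted_eq tr irr) => //.
      (* The letter 0 is a mere placeholder: deleting the new point leaves a sorted list. *)
      apply: (subseq_sorted tr _ (sep 0%N)).
      by rewrite cat_subseq // subseq_cons.
    move=> z; rewrite mem_cat !mem_filter -andb_orl.
    have [zZ|] := boolP (z \in Z); last by rewrite andbF.
    by rewrite andbT -neq_lt; symmetry; apply: contraNneq xZ => <-; apply: map_f.
  have [||c cK Wc] := Wstep (map snd Zl) (map snd Zr).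
  - by rewrite -map_cat -defZ.
  - by rewrite -map_cat -defZ size_map; lia.
  have yc : ((0 : R) < (band K (x, c)).2 < 1)%R by apply: band_unit.
  apply: (IHt (Zl ++ (x, c) :: Zr) _ (sep c) _ _ _ (Ax _ yc)).
  - by rewrite map_cat.
  - move=> p; rewrite inE map_cat mem_cat /= inE => /predU1P[->|/PZ].
      by rewrite eqxx orbT.
    by rewrite {1}defZ map_cat mem_cat => /orP[->|->]; rewrite ?orbT.
  - by move: szZ; rewrite {1}defZ !size_cat /=; lia.
rewrite /ESO; case: ex_minnP => t /asboolP At _.
by rewrite ltnNge; apply/negP => tN; apply: (surv t [::] [::]).
Qed.

(** * Splitting concatenations and sorted words *)

Lemma subseq_cat_split (T : eqType) (s x y : seq T) :
  subseq s (x ++ y) -> exists s1 s2, [/\ s = s1 ++ s2, subseq s1 x & subseq s2 y].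
Proof.
case/subseqP=> b szb ->; rewrite size_cat in szb.
exists (mask (take (size x) b) x), (mask (drop (size x) b) y).
rewrite !mask_subseq -mask_cat ?cat_take_drop // size_takel //; lia.
Qed.

Lemma size_uniq_interval (s : seq nat) (a b : nat) :
  uniq s -> {in s, forall c, a <= c < b} -> size s <= b - a.
Proof.
move=> us sab; rewrite -(size_iota a (b - a)); apply: uniq_leq_size => // c cs.
by rewrite mem_iota; have := sab _ cs; lia.
Qed.

Lemma all_eq_size_count (T : eqType) (x : T) (s w : seq T) :
  subseq s w -> {in s, forall c, c = x} -> size s <= count_mem x w.
Proof.
move=> sw sx;
have /eqP <- : count_mem x s == size s.
  by rewrite -all_count; apply/allP => c /sx ->; rewrite /= eqxx.
exact: leq_count_subseq.
Qed.

(** Locates a gap of the word inside a cell; a gap on a boundary goes to the leftmost possible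
    cell. *)
Lemma flatten_cat_split (T : Type) (cs : seq (seq T)) (u v : seq T) :
    flatten cs = u ++ v -> 0 < size cs ->
  exists cs1 a b cs2,
    [/\ cs = cs1 ++ (a ++ b) :: cs2, u = flatten cs1 ++ a & v = b ++ flatten cs2].
Proof.
elim: cs u => [//|s cs IHcs] u /= def_uv _.
have [le_us|lt_su] := leqP (size u) (size s).
  exists [::], u, (drop (size u) s), cs.
  have def_s : s = u ++ drop (size u) s.
    rewrite -[LHS](cat_take_drop (size u)); congr (_ ++ _).
    by have := congr1 (take (size u)) def_uv; rewrite [RHS]take_size_cat // takel_cat.
  split=> //=; first by rewrite -def_s.
  have := congr1 (drop (size u)) def_uv; rewrite [RHS]drop_size_cat // drop_cat.
  case: ltnP => // le_su <-; have -> : size u = size s by lia.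
  by rewrite subnn drop0 drop_size.
have def_u : u = s ++ drop (size s) u.
  rewrite -[LHS](cat_take_drop (size s)); congr (_ ++ _).
  have := congr1 (take (size s)) def_uv; rewrite [LHS]take_size_cat // takel_cat //.
  exact: ltnW.
have def_cs : flatten cs = drop (size s) u ++ v.
  have := congr1 (drop (size s)) def_uv; rewrite [LHS]drop_size_cat // => ->.
  by rewrite drop_cat lt_su.
case: cs IHcs def_cs {def_uv} => [|s' cs'] IHcs def_cs.
  have : size (drop (size s) u) = 0 by move/(congr1 size): def_cs; rewrite size_cat /=; lia.
  by rewrite size_drop; lia.
have [//|cs1 [a [b [cs2 [-> def_u' ->]]]]] := IHcs _ def_cs.
exists (s :: cs1), a, b, cs2; split=> //.
by rewrite def_u def_u' /= catA.
Qed.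

Lemma cat_subseq_split (T : eqType) (s1 s2 w : seq T) :
  subseq (s1 ++ s2) w -> exists u v, [/\ w = u ++ v, subseq s1 u & subseq s2 v].
Proof.
elim: w s1 => [|y w IHw] [|x s1]; try by exists [::], [::].
- by move=> s2w; exists [::], (y :: w).
- rewrite /= ; case: eqP => [<-|_] /=.
    by case/IHw=> u [v [-> s1u s2v]]; exists (x :: u), v; rewrite /= eqxx.
  case/(IHw (x :: s1))=> u [v [-> s1u s2v]]; exists (y :: u), v; split=> //.
  exact: subseq_trans s1u (subseq_cons _ _).
Qed.

Lemma insert_split (T : Type) (c : T) (u v a b : seq T) :
    u ++ c :: v = a ++ b ->
  (exists2 u2, u = a ++ u2 & b = u2 ++ c :: v) \/
  (exists2 v1, a = u ++ c :: v1 & v = v1 ++ b).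
Proof.
elim: u a => [|x u IHu] [|y a] /=.
- by move=> <-; left; exists [::].
- by case=> <- ->; right; exists a.
- by move=> <-; left; exists (x :: u).
case=> <- /IHu[[u2 -> ->]|[v1 -> ->]]; first by left; exists u2.
by right; exists v1.
Qed.

Lemma sorted_leq_split (a : nat) (s : seq nat) :
  sorted leq s -> s = [seq c <- s | c < a] ++ [seq c <- s | a <= c].
Proof.
elim: s => //= x s IHs; rewrite (path_sortedE leq_trans) => /andP[/allP xs ss].
rewrite {1}(IHs ss); case: (ltnP x a) => //= le_ax.
rewrite (eq_in_filter (a2 := pred0)) ?filter_pred0 //= => c /xs; lia.
Qed.

(** * The case j = 2: one inner letter 1 between the outer letters 0 and 2 *)

Definition three_band_word (n : nat) (w : seq nat) : Prop :=
  [/\ all (ltn^~ 3) w, count_mem 1 w <= n,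
      count_mem 1 w < n -> all (pred1 1) w,
      forall u v, w = u ++ v -> count_mem 0 u <= count_mem 1 u
    & forall u v, w = u ++ v -> count_mem 2 v <= count_mem 1 v].


(** An exchange argument: a chain consists of 0's in a prefix, then 1's, then 2's in a suffix. By
    the two ballot conditions, trading the 0's and the 2's for the 1's of that prefix and suffix
    does not shorten it, and there are at most [n] 1's. *)
Lemma three_band_chain (n : nat) (w s : seq nat) :
  three_band_word n w -> subseq s w -> sorted leq s -> size s <= n.
Proof.
case=> /allP w3 wn _ w0 w2 sw ss.
have s3 c : c \in s -> c < 3 by move/(mem_subseq sw)/w3.
have ss1 : sorted leq [seq c <- s | 1 <= c] := sorted_filter leq_trans _ ss.
have def_s := sorted_leq_split 1 ss.
rewrite [X in _ ++ X](sorted_leq_split 2 ss1) in def_s.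
move: (sw); rewrite {1}def_s.
case/cat_subseq_split=> u [v [def_w s0u]] /cat_subseq_split[v1 [v2 [def_v s1v s2v]]].
have := all_eq_size_count (x := 0) s0u; have := all_eq_size_count (x := 1) s1v.
have := all_eq_size_count (x := 2) s2v.
have /= := w0 u v def_w; have := w2 (u ++ v1) v2.
rewrite def_w def_v catA => /(_ erefl) /= c2 c0.
move: wn; rewrite def_w def_v !count_cat => wn h2 h1 h0.
have {}h0 : size [seq c <- s | c < 1] <= count_mem 0 u.
  by apply: h0 => c; rewrite mem_filter => /andP[]; lia.
have {}h1 : size [seq c <- [seq c <- s | 0 < c] | c < 2] <= count_mem 1 v1.
  by apply: h1 => c; rewrite !mem_filter => /andP[c2' /andP[c1 _]]; lia.
have {}h2 : size [seq c <- [seq c <- s | 0 < c] | 1 < c] <= count_mem 2 v2.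
  by apply: h2 => c; rewrite !mem_filter => /andP[c2' /andP[_ /s3]]; lia.
rewrite def_s !size_cat.
exact: leq_trans (leq_add (leq_trans h0 c0) (leq_add h1 (leq_trans h2 c2))) wn.
Qed.

(** Once all 1's are present, a blocked 0 yields a prefix reaching the gap with as many 0's as 1's,
    and a blocked 2 such a suffix. Together they cover the word, so it has at least [n] outer
    letters besides its [n] 1's. *)
Lemma three_band_step (n : nat) (u v : seq nat) :
    three_band_word n (u ++ v) -> size (u ++ v) < 2 * n ->
  exists2 c, c < 3 & three_band_word n (u ++ c :: v).
Proof.
case=> w3 wn w1 w0 w2 lt_size.
have w3' c : c < 3 -> all (ltn^~ 3) (u ++ c :: v).
  by move=> c3; move: w3; rewrite !all_cat /= c3.
have [lt1|ge1] := ltnP (count_mem 1 (u ++ v)) n.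
  exists 1 => //.
  have w11 : all (pred1 1) (u ++ 1 :: v).
    by have := w1 lt1; rewrite !all_cat.
  have c1 x : x != 1 -> count_mem x (u ++ 1 :: v) = 0.
    move=> x1; apply/eqP; rewrite -leqn0 leqNgt -has_count; apply/hasPn => c /(allP w11).
    by move=> /eqP ->; rewrite /= eq_sym.
  split=> //; first exact: w3'.
  - by move: lt1; rewrite !count_cat /=; lia.
  - by move=> a b ab; have := c1 0 isT; rewrite ab count_cat; lia.
  - by move=> a b ab; have := c1 2 isT; rewrite ab count_cat; lia.
have {}wn : count_mem 1 (u ++ v) = n by lia.
have [[v1 [v2 [def_v S_bad]]]|S_ok] :=
    pselect (exists v1 v2, v = v1 ++ v2 /\ count_mem 1 (u ++ v1) <= count_mem 0 (u ++ v1)).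
have [[u1 [u2 [def_u T_bad]]]|T_ok] :=
    pselect (exists u1 u2, u = u1 ++ u2 /\ count_mem 1 (u2 ++ v) <= count_mem 2 (u2 ++ v)).
- suff : 2 * n <= size (u ++ v) by rewrite leqNgt lt_size.
  have sum3 : size (u ++ v) = count_mem 0 (u ++ v) + count_mem 1 (u ++ v) + count_mem 2 (u ++ v).
    by elim: (u ++ v) w3 => //= x w IHw /andP[x3 /IHw ->]; case: x x3 => [|[|[|x]]] //=; lia.
  move: sum3 wn S_bad T_bad; rewrite def_u def_v !count_cat; lia.
- exists 2 => //; split; first exact: w3'.
  + by move: wn; rewrite !count_cat /=; lia.
  + by move: wn; rewrite !count_cat /=; lia.
  + move=> a b eq_ab; case: (insert_split eq_ab) => [[a2 def_a _]|[b1 -> def_b]].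
      by apply: (w0 a (a2 ++ v)); rewrite def_a catA.
    have eq_uv : u ++ v = (u ++ b1) ++ b by rewrite def_b catA.
    by have := w0 _ _ eq_uv; rewrite !count_cat /=; lia.
  + move=> a b eq_ab; case: (insert_split eq_ab) => [[a2 def_a ->]|[b1 _ def_b]].
      have : count_mem 2 (a2 ++ v) < count_mem 1 (a2 ++ v).
        by rewrite ltnNge; apply/negP => bad; apply: T_ok; exists a, a2.
      by rewrite !count_cat /=; lia.
    by apply: (w2 (u ++ b1) b); rewrite def_b catA.
- exists 0 => //; split; first exact: w3'.
  + by move: wn; rewrite !count_cat /=; lia.
  + by move: wn; rewrite !count_cat /=; lia.
  + move=> a b eq_ab; case: (insert_split eq_ab) => [[u2 def_u _]|[v1 -> def_v]].
      by apply: (w0 a (u2 ++ v)); rewrite def_u catA.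
    have : count_mem 0 (u ++ v1) < count_mem 1 (u ++ v1).
      by rewrite ltnNge; apply/negP => bad; apply: S_ok; exists v1, b.
    by rewrite !count_cat /=; lia.
  + move=> a b eq_ab; case: (insert_split eq_ab) => [[u2 def_u ->]|[v1 _ def_v]].
      have eq_uv : u ++ v = a ++ (u2 ++ v) by rewrite def_u catA.
      by have := w2 _ _ eq_uv; rewrite !count_cat /=; lia.
    by apply: (w2 (u ++ v1) b); rewrite def_v catA.
Qed.

(** * Lists of cells with the numbers of their neighbours *)

Section CellsAt.
Variable P : nat -> nat -> seq nat -> Prop.

(** [r] counts cells beyond the end of the list, so that the condition makes sense for a block of a
    longer list. *)
Fixpoint cells_at (i : nat) (cs : seq (seq nat)) (r : nat) : Prop :=
  if cs is s :: cs' then P i (size cs' + r) s /\ cells_at i.+1 cs' r else True.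

Lemma cells_at_cat i cs1 cs2 r :
  cells_at i (cs1 ++ cs2) r <->
  cells_at i cs1 (size cs2 + r) /\ cells_at (i + size cs1) cs2 r.
Proof.
elim: cs1 i => [|s cs1 IHcs] i /=; first by rewrite addn0; tauto.
rewrite IHcs addSnnS size_cat addnA; tauto.
Qed.

Hypothesis P_shift_right : forall i r s, P i r.+1 s -> P i r.+2 s.
Hypothesis P_shift_left : forall i r s, P i.+1 r s -> P i.+2 r s.

(** Cutting a cell gives those before it one more cell on the right. Only positive counts are
    shifted, because end cells obey special rules. *)
Lemma cells_at_shift_right i cs r : cells_at i cs r.+1 -> cells_at i cs r.+2.
Proof.
elim: cs i => //= s cs IHcs i [Ps /IHcs]; split=> //.
by rewrite !addnS in Ps *; apply: P_shift_right.
Qed.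

Lemma cells_at_shift_left i cs r : cells_at i.+1 cs r -> cells_at i.+2 cs r.
Proof.
by elim: cs i => //= s cs IHcs i [Ps /IHcs]; split=> //; apply: P_shift_left.
Qed.
End CellsAt.

Lemma count_flatten_replace (P : pred nat) (cs1 cs2 : seq (seq nat)) (s s' : seq nat) (e i : nat) :
    count P s' = count P s + e ->
  count P (flatten (take i (cs1 ++ s' :: cs2))) =
    count P (flatten (take i (cs1 ++ s :: cs2))) + e * (size cs1 < i) /\
  count P (flatten (drop i (cs1 ++ s' :: cs2))) =
    count P (flatten (drop i (cs1 ++ s :: cs2))) + e * (i <= size cs1).
Proof.
move=> def_s'; rewrite !take_cat !drop_cat; case: (ltngtP i (size cs1)) => [lt_i|gt_i|->].
- by rewrite !flatten_cat !count_cat /= ?count_cat def_s'; split; lia.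
- rewrite !flatten_cat !count_cat; have -> : i - size cs1 = (i - size cs1).-1.+1 by lia.
  by rewrite /= ?count_cat def_s'; split; lia.
by rewrite subnn take0 drop0 /= ?count_cat def_s'; split; lia.
Qed.

(** * The invariant for j at least 3 *)

Section Cells.
Variables p kap : nat.
Hypothesis p2 : 2 <= p.
(** Here [p] is j - 1 and [kap] is 2 j - 3. A full cell together with one new letter has [kap.+1]
    letters, exactly enough for two cells of [p] letters; an end cell is allowed one letter less for
    its barred letter. *)
Hypothesis kapE : kap.+1 = p.*2.

Definition inner (c : nat) : bool := 0 < c <= kap.

(* [i] and [r] count the cells to the left and to the right. *)
Definition cell_ok (i r : nat) (s : seq nat) : Prop :=
  [/\ uniq [seq c <- s | inner c], all (ltn^~ kap.+2) s,
      i = 0 -> 1 \notin s, r = 0 -> kap \notin s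
    & 0 < i + r -> p <= count inner s + (i == 0) + (r == 0)].

Lemma cell_ok_shift_right i r s : cell_ok i r.+1 s -> cell_ok i r.+2 s.
Proof. by case=> us s_lt s1 _ low; split=> // _; apply: low; rewrite addnS. Qed.

Lemma cell_ok_shift_left i r s : cell_ok i.+1 r s -> cell_ok i.+2 r s.
Proof. by case=> us s_lt _ sk low; split=> // _; apply: low; rewrite addSn. Qed.

(* The last two clauses ration the outer letters 0 and [kap.+1]: the r-th 0 from
   the left lies in a cell number at least [r.+1], and symmetrically. *)
Definition cells_ok (Q : nat) (cs : seq (seq nat)) : Prop :=
  [/\ 0 < size cs <= Q, cells_at cell_ok 0 cs 0,
      size cs < Q -> all inner (flatten cs),
      forall i, count_mem 0 (flatten (take i cs)) <= i.-2
    & forall i, count_mem kap.+1 (flatten (drop i cs)) <= (size cs - i).-2].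

(** * Bounding the increasing subwords *)

Lemma take_bound_cat (P : pred nat) (cs1 cs2 : seq (seq nat)) :
    (forall i, count P (flatten (take i (cs1 ++ cs2))) <= i.-2) ->
  forall i, count P (flatten (take i cs1)) <= i.-2.
Proof.
move=> bound i; have [le_i|lt_i] := leqP i (size cs1).
  by have := bound i; rewrite takel_cat.
rewrite (take_oversize (ltnW lt_i)).
by have := bound (size cs1); rewrite takel_cat // take_size; lia.
Qed.

(** Labels start at 2, as letter 1 is barred from the first cell, and letter [c] in the last cell
    has label [(size cs).-1 + c]. The induction removes the last cell: if the chain enters it at an
    inner letter [d], that cell contributes distinct letters from [d] to [c], and the earlier cells
    are bounded with [d] in place of [c]. *)
Lemma chain_le (cs : seq (seq nat)) (r c : nat) (s : seq nat) :
    cells_at cell_ok 0 cs r -> (forall i, count_mem 0 (flatten (take i cs)) <= i.-2) ->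
    0 < size cs -> 0 < c <= kap ->
    subseq s (flatten cs) -> sorted leq s -> {in s, forall d, d <= c} ->
  size s + 2 <= size cs + c.
Proof.
elim/last_ind: cs r c s => [//|cs a IHcs] r c s cs_ok zeros _ c_in.
rewrite -cats1 flatten_cat /= cats0 => s_sub s_sorted s_le.
move: cs_ok; rewrite -cats1 cells_at_cat /= add0n => -[cs_ok [[ua a_lt a1 _ _] _]].
have zeros' : forall i, count_mem 0 (flatten (take i cs)) <= i.-2.
  by apply: (@take_bound_cat _ _ [:: a]) => i; rewrite cats1.
rewrite size_cat /= addn1.
have [s1 [s2 [def_s s1_sub s2_sub]]] : exists s1 s2 : seq nat,
    [/\ s = s1 ++ s2, subseq s1 (flatten cs) & subseq s2 a] := subseq_cat_split s_sub.
have s2_ok d : 0 < d -> {in s2, forall e, d <= e} -> size s2 <= c.+1 - d.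
  move=> d0 s2_ge; apply: size_uniq_interval => [|e e_s2].
    apply: subseq_uniq ua; have -> : s2 = [seq e <- s2 | inner e].
      symmetry; apply/all_filterP/allP => e e_s2; have := s2_ge _ e_s2.
      by have := s_le e; rewrite def_s mem_cat e_s2 orbT /inner => /(_ isT); lia.
    rewrite subseq_filter filter_all (subseq_trans _ s2_sub) ?filter_subseq //.
  by have := s2_ge _ e_s2; have := s_le e; rewrite def_s mem_cat e_s2 orbT => /(_ isT); lia.
have ss := s_sorted; rewrite def_s in ss.
case def_s2 : s2 ss => [|d s2'] ss.
  rewrite def_s def_s2 cats0.
  case: (posnP (size cs)) => [/size0nil cs0|cs_gt0].
    by move: s1_sub; rewrite cs0 subseq0 => /eqP -> /=; lia.
  suff : size s1 + 2 <= size cs + c by lia.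
  apply: (IHcs _ _ _ cs_ok) => //; first by rewrite cats0 in ss.
  by move=> e e_s1; apply: s_le; rewrite def_s mem_cat e_s1.
have s2_ge : {in s2, forall e, d <= e}.
  have := cat_sorted2 ss => -[_]; rewrite /= (path_sortedE leq_trans) => /andP[/allP ge_d _].
  by move=> e; rewrite def_s2 inE => /predU1P[->|/ge_d].
have s1_le : {in s1, forall e, e <= d}.
  move=> e e_s1; move: ss; rewrite sorted_cat_cons => /andP[+ _].
  rewrite -cats1 (sorted_pairwise leq_trans) pairwise_cat => /and3P[/allrelP h _ _].
  by apply: h; rewrite // inE.
have d_s2 : d \in s2 by rewrite def_s2 mem_head.
have d_le : d <= c by apply: s_le; rewrite def_s mem_cat d_s2 orbT.
rewrite -def_s2 in ss.
have [d0|d_gt0] := posnP d; last first.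
  case: (posnP (size cs)) => [/size0nil cs0|cs_gt0].
    (* With a single cell, the bar on letter 1 supplies the unit that the induction cannot. *)
    have d1 : d != 1.
      apply/eqP => d1; move: a1; rewrite cs0 => /(_ erefl) /negP; apply.
      by rewrite -d1 (mem_subseq s2_sub).
    move: s1_sub; rewrite cs0 subseq0 => /eqP s10.
    by have := s2_ok d d_gt0 s2_ge; rewrite def_s s10 /=; lia.
  have d_in : 0 < d <= kap by lia.
  have s1_sorted : sorted leq s1 by case/cat_sorted2: ss.
  have := IHcs _ d s1 cs_ok zeros' cs_gt0 d_in s1_sub s1_sorted s1_le.
  by have := s2_ok d d_gt0 s2_ge; rewrite def_s size_cat; lia.
(* The chain enters the last cell through letter 0: it consists of 0's, at most
   [(size cs).+1.-2] of them, followed by distinct inner letters of that cell. *)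
have s1_zero : {in s1, forall e, e = 0} by move=> e /s1_le; lia.
have s2_sorted : sorted leq s2 by case/cat_sorted2: ss.
have def_s2' := sorted_leq_split 1 s2_sorted.
have rest : size [seq e <- s2 | 0 < e] <= c.
  rewrite -[leqRHS]subn0 -subSS; apply: size_uniq_interval => [|e].
    apply: subseq_uniq ua.
    have -> : [seq e <- s2 | 0 < e] = [seq e <- s2 | inner e].
      apply: eq_in_filter => e e_s2; have := s_le e.
      by rewrite def_s mem_cat e_s2 orbT /inner => /(_ isT); lia.
    by rewrite subseq_filter filter_all (subseq_trans _ s2_sub) ?filter_subseq.
  rewrite mem_filter => /andP[e0 e_s2]; have := s_le e.
  by rewrite def_s mem_cat e_s2 orbT => /(_ isT); lia.
have zero_sub : subseq (s1 ++ [seq e <- s2 | e < 1]) (flatten (rcons cs a)).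
  rewrite -cats1 flatten_cat /= cats0 cat_subseq //.
  by apply: subseq_trans s2_sub; apply: filter_subseq.
have := all_eq_size_count (x := 0) zero_sub.
have := zeros (size cs).+1; rewrite take_oversize ?size_rcons // => z1 z2.
have {}z2 : size (s1 ++ [seq e <- s2 | e < 1]) <= count_mem 0 (flatten (rcons cs a)).
  apply: z2 => e; rewrite mem_cat mem_filter => /orP[/s1_zero //|/andP[]]; lia.
have z3 : 0 < size (s1 ++ [seq e <- s2 | e < 1]).
  rewrite size_cat addn_gt0 size_filter -has_count; apply/orP; right.
  by apply/hasP; exists d => //; rewrite d0.
have := leq_trans z2 z1; move: z3; rewrite def_s [in X in size X + 2 <= _]def_s2' !size_cat; lia.
Qed.

Lemma cells_lt i cs r : cells_at cell_ok i cs r -> all (ltn^~ kap.+2) (flatten cs).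
Proof.
by elim: cs i => //= s cs IHcs i [[_ s_lt _ _ _] /IHcs cs_lt]; rewrite all_cat s_lt.
Qed.

(** The chain is cut where its top letters begin. If cells remain to the right of that cell, the
    ration of top letters saves one more unit than [chain_le]; otherwise the bar on [kap] in the
    last cell does. *)
Lemma cells_chain (Q : nat) (cs : seq (seq nat)) (s : seq nat) :
  cells_ok Q cs -> subseq s (flatten cs) -> sorted leq s -> size s + 3 <= size cs + kap.
Proof.
case=> /andP[cs_gt0 _] cs_ok _ zeros tops s_sub ss.
have s_lt c : c \in s -> c < kap.+2.
  by move/(mem_subseq s_sub); apply: (allP (cells_lt cs_ok)).
have def_s := sorted_leq_split kap.+1 ss.
set s1 := [seq c <- s | c < _] in def_s; set s2 := [seq c <- s | _ <= c] in def_s.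
have [ss1 _] := cat_sorted2 (eq_ind _ (sorted leq) ss _ def_s).
have s1_le : {in s1, forall c, c <= kap} by move=> c; rewrite mem_filter => /andP[].
have kap_in : 0 < kap <= kap by lia.
move: (s_sub); rewrite {1}def_s.
move=> /cat_subseq_split split_uv.
have [u [v [def_uv s1_sub s2_sub]]] : exists u v : seq nat,
  [/\ flatten cs = u ++ v, subseq s1 u & subseq s2 v] := split_uv.
have [cs1 [a [b [cs2 [def_cs def_u def_v]]]]] := flatten_cat_split def_uv cs_gt0.
have size_cs : size cs = size cs1 + (size cs2).+1 by rewrite def_cs size_cat.
have cs_ok' := cs_ok; rewrite def_cs cells_at_cat /= in cs_ok'.
rewrite !addn0 add0n in cs_ok'; case: cs_ok' => cs1_ok [ab_ok _].
have s2_size : size s2 <= (size cs2).-1.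
  apply: leq_trans (all_eq_size_count (x := kap.+1) s2_sub _) _.
    by move=> c; rewrite mem_filter => /andP[c_gt /s_lt]; lia.
  have := tops (size cs1); rewrite size_cs {1}def_cs drop_size_cat //= def_v !count_cat; lia.
have size_s : size s = size s1 + size s2 by rewrite {1}def_s size_cat.
case: (posnP (size cs2)) => [/size0nil cs2_0|cs2_gt0]; last first.
  suff : size s1 + 2 <= size (cs1 ++ [:: a ++ b]) + kap by rewrite size_cat /=; lia.
  apply: (@chain_le _ (size cs2)) => //.
  - by rewrite cells_at_cat /= !add0n.
  - by apply: (@take_bound_cat _ _ cs2); rewrite -catA -def_cs.
  - by rewrite size_cat addn1.
  - apply: subseq_trans s1_sub _; rewrite def_u flatten_cat /= cats0.
    by rewrite cat_subseq // prefix_subseq.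
have {}size_s : size s = size s1 by move: s2_size; rewrite cs2_0 /=; lia.
have s1_sub' : subseq s1 (flatten cs1 ++ (a ++ b)).
  by apply: subseq_trans s1_sub _; rewrite def_u cat_subseq // prefix_subseq.
have [t1 [t2 [def_s1 t1_sub t2_sub]]] : exists t1 t2 : seq nat,
    [/\ s1 = t1 ++ t2, subseq t1 (flatten cs1) & subseq t2 (a ++ b)]
  := subseq_cat_split s1_sub'.
(* Either the chain avoids the last cell, so that one cell fewer counts, or it meets that cell and
   all its letters are at most [kap.-1]. *)
case def_t2 : t2 => [|d t2'].
  have {}def_s1 : s1 = t1 by rewrite def_s1 def_t2 cats0.
  rewrite size_s size_cs; case: (posnP (size cs1)) => [/size0nil cs1_0|cs1_gt0].
    by move: t1_sub; rewrite cs1_0 subseq0 -def_s1 => /eqP -> /=; lia.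
  suff : size s1 + 2 <= size cs1 + kap by lia.
  apply: (@chain_le _ (size cs2).+1) => //; last by rewrite def_s1.
  by apply: (@take_bound_cat _ _ ((a ++ b) :: cs2)); rewrite -def_cs.
have t2_lt e : e \in t2 -> e <= kap.-1.
  move=> e_t2; have : e <= kap by apply: s1_le; rewrite def_s1 mem_cat e_t2 orbT.
  case: ab_ok => _ _ _ + _; rewrite cs2_0 => /(_ erefl) kap_ab.
  have : e != kap by apply: contraNneq kap_ab => <-; apply: mem_subseq e_t2.
  by lia.
suff : size s1 + 2 <= size cs + kap.-1 by lia.
apply: (@chain_le _ 0) => //; first by lia.
  by rewrite def_uv (subseq_trans s1_sub) // prefix_subseq.
move=> e; rewrite def_s1 mem_cat => /orP[e_t1|/t2_lt //].
apply: leq_trans (t2_lt d _); last by rewrite def_t2 mem_head.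
move: ss1; rewrite def_s1 def_t2 sorted_cat_cons => /andP[+ _].
rewrite -cats1 (sorted_pairwise leq_trans) pairwise_cat => /and3P[/allrelP h _ _].
by apply: h; rewrite // inE.
Qed.

(** * Counting the letters in full and in ordinary cells *)

Lemma cell_full_count (i r : nat) (s : seq nat) :
    (forall c, inner c -> (i = 0 -> c != 1) -> (r = 0 -> c != kap) -> c \in s) ->
  kap <= count inner s + (i == 0) + (r == 0).
Proof.
move=> full; rewrite -size_filter.
have sub : {subset iota (1 + (i == 0)) (kap - (i == 0) - (r == 0)) <= filter inner s}.
  move=> c; rewrite mem_iota mem_filter => c_in.
  have c_inner : inner c by rewrite /inner; lia.
  rewrite c_inner; apply: full => // [i0|r0]; first by move: c_in; rewrite i0; lia.
  by move: c_in; rewrite r0; lia.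
have : size (iota (1 + (i == 0)) (kap - (i == 0) - (r == 0))) <= size (filter inner s).
  by apply: uniq_leq_size => //; apply: iota_uniq.
by rewrite size_iota; lia.
Qed.

(** Each cell has at least [p] inner letters, except that the first one may lack one; [r.+1] ensures
    that none of them is the last cell. *)
Lemma count_left_cells cs r :
  cells_at cell_ok 0 cs r.+1 -> p * size cs <= count inner (flatten cs) + (0 < size cs).
Proof.
have tail i cs' : cells_at cell_ok i.+1 cs' r.+1 -> p * size cs' <= count inner (flatten cs').
  elim: cs' i => [|s cs' IHcs] i /=; first by rewrite muln0.
  case=> [[_ _ _ _ /(_ isT)]] + /IHcs.
  by rewrite addnS count_cat mulnS /= !addn0; lia.
case: cs => [|s cs] /=; first by rewrite muln0.
case=> [[_ _ _ _ low]] /tail; move: low; rewrite addnS => /(_ isT).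
by rewrite count_cat mulnS /= !addn0; lia.
Qed.

Lemma count_right_cells i cs :
  cells_at cell_ok i.+1 cs 0 -> p * size cs <= count inner (flatten cs) + (0 < size cs).
Proof.
elim: cs i => [|s cs IHcs] i /=; first by rewrite muln0.
case=> [[_ _ _ _ /(_ isT)]] + /IHcs; rewrite addn0 count_cat mulnS /= addn0.
by case: cs {IHcs} => [|s' cs] /=; rewrite ?muln0 ?addn0; lia.
Qed.

Lemma count_letters_le (s : seq nat) :
  count inner s + count_mem 0 s + count_mem kap.+1 s <= size s.
Proof. by elim: s => //= c s IHs; rewrite {1}/inner; lia. Qed.

(** * Moves that preserve the invariant *)

Lemma cell_ok_insert (i r c : nat) (a b : seq nat) :
    cell_ok i r (a ++ b) -> c < kap.+2 -> (inner c -> c \notin a ++ b) ->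
    (i = 0 -> c != 1) -> (r = 0 -> c != kap) ->
  cell_ok i r (a ++ c :: b).
Proof.
case=> us s_lt s1 sk low c_lt c_new c1 ck.
have E : perm_eq (a ++ c :: b) (c :: (a ++ b)) by rewrite (perm_catCA a [:: c] b).
split.
- rewrite (perm_uniq (perm_filter inner E)) /=; case: ifP => //= c_in.
  by rewrite us mem_filter negb_and c_new ?orbT.
- by rewrite (perm_all _ E) /= c_lt.
- by move=> i0; rewrite (perm_mem E) inE negb_or eq_sym c1 ?s1.
- by move=> r0; rewrite (perm_mem E) inE negb_or eq_sym ck ?sk.
- by move=> /low; rewrite (permP E) /=; lia.
Qed.

(** Common core of the insertions: [e0] and [eT] count the new outer letters, and the rations need
    checking only on prefixes and suffixes that contain the changed cell. *)
Lemma cells_ok_replace (Q e0 eT : nat) (cs1 cs2 : seq (seq nat)) (s s' : seq nat)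
    (cs := cs1 ++ s :: cs2) :
    cells_ok Q cs -> cell_ok (size cs1) (size cs2) s' ->
    count_mem 0 s' = count_mem 0 s + e0 ->
    count_mem kap.+1 s' = count_mem kap.+1 s + eT ->
    (size cs < Q -> all inner s') ->
    (forall i, size cs1 < i -> count_mem 0 (flatten (take i cs)) + e0 <= i.-2) ->
    (forall i, i <= size cs1 ->
       count_mem kap.+1 (flatten (drop i cs)) + eT <= (size cs - i).-2) ->
  cells_ok Q (cs1 ++ s' :: cs2).
Proof.
case=> cs_size cs_ok cs_in zeros tops s'_ok count0 countT s'_in zeros' tops'.
have size_cs : size (cs1 ++ s' :: cs2) = size cs by rewrite !size_cat.
split; rewrite ?size_cs //.
- move: cs_ok; rewrite !cells_at_cat /= !addn0 => -[? [_ ?]]; split=> //; split=> //.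
- move=> lt_Q; have := cs_in lt_Q; rewrite !flatten_cat /= !all_cat s'_in //.
  by case/and3P=> -> _ ->.
- move=> i; have [-> _] := count_flatten_replace cs1 cs2 i count0.
  by case: (ltnP (size cs1) i) => [/zeros'|_]; rewrite ?muln1 // muln0 addn0.
- move=> i; have [_ ->] := count_flatten_replace cs1 cs2 i countT.
  by case: (leqP i (size cs1)) => [/tops'|_]; rewrite ?muln1 // muln0 addn0.
Qed.

Lemma cells_ok_cell (Q : nat) (cs1 cs2 : seq (seq nat)) (s : seq nat) :
  cells_ok Q (cs1 ++ s :: cs2) -> cell_ok (size cs1) (size cs2) s.
Proof. by case=> _ + _ _ _; rewrite cells_at_cat /= !addn0 add0n; case=> _ []. Qed.

Lemma cells_ok_insert_inner (Q c : nat) (cs1 cs2 : seq (seq nat)) (a b : seq nat) :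
    cells_ok Q (cs1 ++ (a ++ b) :: cs2) -> inner c -> c \notin a ++ b ->
    (size cs1 = 0 -> c != 1) -> (size cs2 = 0 -> c != kap) ->
  cells_ok Q (cs1 ++ (a ++ c :: b) :: cs2).
Proof.
move=> ok c_in c_new c1 ck; have [_ cs_ok cs_in zeros tops] := ok.
have c_lt : 0 < c < kap.+1 by case/andP: c_in => ? ?; lia.
apply: (@cells_ok_replace _ 0 0 _ _ _ _ ok).
- by apply: cell_ok_insert => //; [apply: cells_ok_cell ok | lia].
- by rewrite !count_cat /=; lia.
- by rewrite !count_cat /=; lia.
- by move=> /cs_in; rewrite flatten_cat /= !all_cat /= c_in => /and3P[_ /andP[-> ->] _].
- by move=> i _; rewrite addn0.
- by move=> i _; rewrite addn0.
Qed.

(* If both outer letters are blocked at a gap of cell [size cs1], then at least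
   [(size cs1).-1] 0's and [(Q - size cs1).-2] top letters have been played. *)
Lemma cells_ok_insert_outer (Q : nat) (cs1 cs2 : seq (seq nat)) (a b : seq nat)
    (cs := cs1 ++ (a ++ b) :: cs2) :
    cells_ok Q cs -> size cs = Q ->
    count_mem 0 (flatten cs) + count_mem kap.+1 (flatten cs) + 3 < Q ->
  exists2 c, c < kap.+2 & cells_ok Q (cs1 ++ (a ++ c :: b) :: cs2).
Proof.
move=> ok size_cs few; have [_ cs_ok cs_in zeros tops] := ok.
have ab_ok := cells_ok_cell ok.
have [[i [gt_i i_bad]]|zero_ok] := pselect (exists i,
    size cs1 < i /\ i.-2 <= count_mem 0 (flatten (take i cs))); last first.
  exists 0 => //; apply: (@cells_ok_replace _ 1 0 _ _ _ _ ok).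
  - by apply: cell_ok_insert => // _; lia.
  - by rewrite !count_cat /=; lia.
  - by rewrite !count_cat /=; lia.
  - by rewrite size_cs ltnn.
  - move=> i gt_i; rewrite addn1 ltnNge; apply/negP => bad; apply: zero_ok.
    by exists i.
  - by move=> i _; rewrite addn0.
have [[j [le_j j_bad]]|top_ok] := pselect (exists i,
    i <= size cs1 /\ (Q - i).-2 <= count_mem kap.+1 (flatten (drop i cs))); last first.
  exists kap.+1 => //; apply: (@cells_ok_replace _ 0 1 _ _ _ _ ok).
  - apply: cell_ok_insert => //; first by rewrite /inner; lia.
      by move=> _; lia.
    by move=> _; lia.
  - by rewrite !count_cat /=; lia.
  - by rewrite !count_cat /= eqxx; lia.
  - by rewrite size_cs ltnn.
  - by move=> i' _; rewrite addn0.
  - move=> i' le_i'; rewrite addn1 size_cs ltnNge; apply/negP => bad; apply: top_ok.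
    by exists i'.
(* As [j <= size cs1 < i], the two exhausted rations add up to at least [Q - 3] outer letters. *)
have : count_mem 0 (flatten (take i cs)) <= count_mem 0 (flatten cs).
  by rewrite -[in leqRHS](cat_take_drop i cs) flatten_cat count_cat leq_addr.
have : count_mem kap.+1 (flatten (drop j cs)) <= count_mem kap.+1 (flatten cs).
  by rewrite -[in leqRHS](cat_take_drop j cs) flatten_cat count_cat leq_addl.
by lia.
Qed.

(** The 2 is the loss from the barred letters: one at each end of the word, whether or not the full
    cell is an end cell. *)
Lemma count_inner_full (Q : nat) (cs1 cs2 : seq (seq nat)) (s : seq nat)
    (cs := cs1 ++ s :: cs2) :
    cells_ok Q cs -> kap <= count inner s + (size cs1 == 0) + (size cs2 == 0) ->
  p * (size cs).-1 + kap <= count inner (flatten cs) + 2.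
Proof.
case=> _ cs_ok _ _ _ s_full.
move: cs_ok; rewrite cells_at_cat /= !addn0 add0n => -[/count_left_cells l [_ /count_right_cells r]].
move: l r s_full; rewrite /cs flatten_cat /= !count_cat size_cat /= addnS /= mulnDr.
by case: (size cs1) => [|n1]; case: (size cs2) => [|n2]; rewrite /= ?muln0; lia.
Qed.

Lemma cell_ok_inner (i r : nat) (s : seq nat) :
    uniq s -> all inner s -> (i = 0 -> 1 \notin s) -> (r = 0 -> kap \notin s) ->
    p <= size s + (i == 0) + (r == 0) ->
  cell_ok i r s.
Proof.
move=> us s_in s1 sk low; split=> //.
- by rewrite (all_filterP s_in).
- by apply: sub_all s_in => c /andP[_] /=; lia.
- by move: s_in; rewrite all_count => /eqP ->.
Qed.

(** With fewer than [Q] cells no outer letter has been played, so the rations hold trivially after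
    the cut. *)
Lemma cells_ok_split (Q : nat) (cs1 cs2 : seq (seq nat)) (s l r : seq nat) :
    cells_ok Q (cs1 ++ s :: cs2) -> size (cs1 ++ s :: cs2) < Q ->
    all inner l -> all inner r ->
    cell_ok (size cs1) (size cs2).+1 l -> cell_ok (size cs1).+1 (size cs2) r ->
  cells_ok Q (cs1 ++ l :: r :: cs2).
Proof.
case=> _ cs_ok cs_in _ _ lt_Q l_in r_in l_ok r_ok.
have all_in : all inner (flatten (cs1 ++ l :: r :: cs2)).
  have := cs_in lt_Q; rewrite !flatten_cat /= !all_cat l_in r_in.
  by case/and3P=> -> _ ->.
have count0 c s' : ~~ inner c -> all inner s' -> count_mem c s' = 0.
  move=> c_out /allP s'_in; apply/eqP; rewrite -leqn0 leqNgt -has_count.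
  by apply: contra c_out; rewrite has_pred1 => /s'_in.
split=> //.
- by move: lt_Q; rewrite !size_cat /=; lia.
- move: cs_ok; rewrite !cells_at_cat /= !addn0 !add0n => -[cs1_ok [_ cs2_ok]].
  split; first by apply: cells_at_shift_right cs1_ok; apply: cell_ok_shift_right.
  split=> //; split=> //; apply: cells_at_shift_left cs2_ok.
  exact: cell_ok_shift_left.
- move=> i; rewrite count0 ?/inner // -/inner.
  by move: all_in; rewrite -{1}(cat_take_drop i (cs1 ++ _)) flatten_cat all_cat => /andP[].
- move=> i; rewrite count0 ?/inner ?ltnn ?andbF // -/inner.
  by move: all_in; rewrite -{1}(cat_take_drop i (cs1 ++ _)) flatten_cat all_cat => /andP[].
Qed.

(* A full cell is cut on the side of the gap that carries at least the required
   number of letters: this side keeps exactly that many, and the new letter is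
   copied from it, so that it is new to the other side. *)
Lemma cells_ok_cut (Q : nat) (cs1 cs2 : seq (seq nat)) (a b : seq nat)
    (cs := cs1 ++ (a ++ b) :: cs2) :
    cells_ok Q cs -> size cs < Q ->
    kap <= count inner (a ++ b) + (size cs1 == 0) + (size cs2 == 0) ->
  exists2 c, c < kap.+2 & exists2 cs', cells_ok Q cs' &
    flatten cs' = (flatten cs1 ++ a) ++ c :: (b ++ flatten cs2).
Proof.
move=> ok lt_Q s_full; have ok_ab := cells_ok_cell ok.
have [_ _ /(_ lt_Q) + _ _] := ok.
rewrite flatten_cat /= !all_cat => /and3P[_ /andP[a_in b_in] _].
have ab_in : all inner (a ++ b) by rewrite all_cat a_in.
case: ok_ab => + _ ab1 abk _; rewrite (all_filterP ab_in) => ab_uniq.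
move: s_full; move: (ab_in); rewrite all_count => /eqP -> s_full.
have in_lt c : c \in a ++ b -> c < kap.+2 by move/(allP ab_in)/andP=> []; lia.
set e1 : nat := size cs1 == 0 in s_full *; set e2 : nat := size cs2 == 0 in s_full *.
have [e1_le e2_le] : e1 <= 1 /\ e2 <= 1 by rewrite !leq_b1.
rewrite size_cat in s_full.
have [le_a|lt_a] := leqP (p - e1) (size a).
  pose y := take (p - e1) a; pose a' := drop (p - e1) a.
  have size_y : size y = p - e1 by rewrite size_takel.
  have def_a : a = y ++ a' by rewrite cat_take_drop.
  (* Since [2 <= p], even an end cell keeps a letter that can be copied. *)
  case def_y : y => [|c y']; first by rewrite def_y /= in size_y; lia.
  have c_y : c \in y by rewrite def_y mem_head.
  have c_ab : c \in a ++ b by rewrite def_a !mem_cat c_y.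
  have sub_r x : x \in a' ++ c :: b -> x \in a ++ b.
    rewrite def_a !(mem_cat, inE) => /or3P[->|/eqP ->|->]; rewrite ?orbT //.
    by rewrite -mem_cat -mem_cat -def_a.
  have sub_l x : x \in y -> x \in a ++ b by rewrite def_a !mem_cat => ->.
  exists c; first exact: in_lt.
  exists (cs1 ++ y :: (a' ++ c :: b) :: cs2); last first.
    by rewrite flatten_cat /= [in RHS]def_a -!catA.
  apply: (cells_ok_split ok lt_Q).
  - by apply/allP => x /sub_l; apply: (allP ab_in).
  - by apply/allP => x /sub_r; apply: (allP ab_in).
  - apply: cell_ok_inner => //.
    + by move: ab_uniq; rewrite def_a -catA cat_uniq => /andP[].
    + by apply/allP => x /sub_l; apply: (allP ab_in).
    + by move=> /ab1; apply: contra; apply: sub_l.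
    + by rewrite size_y -/e1; lia.
  - apply: cell_ok_inner => //.
    + move: ab_uniq; rewrite def_a -catA def_y /= => /andP[c_new].
      rewrite cat_uniq => /and3P[_ _ a'b_uniq].
      rewrite -cat1s uniq_catCA /= a'b_uniq andbT.
      by move: c_new; rewrite mem_cat negb_or => /andP[].
    + by apply/allP => x /sub_r; apply: (allP ab_in).
    + by move=> /abk; apply: contra; apply: sub_r.
    + rewrite size_cat /= -/e2; have := size_cat y a'; rewrite -def_a size_y; lia.
(* The left side has at most [p - e1 - 1] of at least [kap - e1 - e2] letters, and [kap.+1] is twice
   [p]. *)
have le_b : p - e2 <= size b by lia.
pose b' := take (size b - (p - e2)) b; pose y := drop (size b - (p - e2)) b.
have size_y : size y = p - e2 by rewrite size_drop; lia.
have def_b : b = b' ++ y by rewrite cat_take_drop.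
case def_y : y => [|c y']; first by rewrite def_y /= in size_y; lia.
have c_y : c \in y by rewrite def_y mem_head.
have c_ab : c \in a ++ b by rewrite def_b !mem_cat c_y !orbT.
have sub_l x : x \in a ++ c :: b' -> x \in a ++ b.
  rewrite def_b !(mem_cat, inE) => /or3P[->|/eqP ->|->]; rewrite ?orbT //.
  by rewrite -mem_cat -mem_cat -def_b.
have sub_r x : x \in y -> x \in a ++ b by rewrite def_b !mem_cat => ->; rewrite !orbT.
exists c; first exact: in_lt.
exists (cs1 ++ (a ++ c :: b') :: y :: cs2); last first.
  by rewrite flatten_cat /= [in RHS]def_b -!catA.
apply: (cells_ok_split ok lt_Q).
- by apply/allP => x /sub_l; apply: (allP ab_in).
- by apply/allP => x /sub_r; apply: (allP ab_in).
- apply: cell_ok_inner => //.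
  + move: ab_uniq; rewrite def_b catA cat_uniq => /and3P[ab'_uniq /hasPn y_new _].
    rewrite -cat1s uniq_catCA /= ab'_uniq andbT; exact: y_new.
  + by apply/allP => x /sub_l; apply: (allP ab_in).
  + by move=> /ab1; apply: contra; apply: sub_l.
  + by rewrite size_cat /= -/e1; have := size_cat b' y; rewrite -def_b size_y; lia.
- apply: cell_ok_inner => //.
  + by move: ab_uniq; rewrite def_b catA cat_uniq => /and3P[].
  + by apply/allP => x /sub_r; apply: (allP ab_in).
  + by move=> /abk; apply: contra; apply: sub_r.
  + by rewrite size_y -/e2; lia.
Qed.

(** B prefers a missing inner letter, then a cut, then an outer letter. In the last case at least
    [p * Q.-1 + kap - 2] letters are inner, so fewer than [Q - 3] are outer; hence the constant
    5. *)
Lemma cells_step (Q : nat) (cs : seq (seq nat)) (u v : seq nat) :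
    cells_ok Q cs -> flatten cs = u ++ v -> size (u ++ v) + 5 < p * Q.-1 + kap + Q ->
  exists2 c, c < kap.+2 & exists2 cs', cells_ok Q cs' & flatten cs' = u ++ c :: v.
Proof.
move=> ok def_uv few; have [/andP[cs_gt0 cs_le] _ _ _ _] := ok.
have [cs1 [a [b [cs2 [def_cs -> ->]]]]] := flatten_cat_split def_uv cs_gt0.
have flat c : flatten (cs1 ++ (a ++ c :: b) :: cs2) =
    (flatten cs1 ++ a) ++ c :: (b ++ flatten cs2).
  by rewrite flatten_cat /= -!catA.
rewrite -def_uv {def_uv} in few; subst cs.
have [[c [c_in c_new c1 ck]]|full] := pselect (exists c, [/\ inner c, c \notin a ++ b,
    size cs1 = 0 -> c != 1 & size cs2 = 0 -> c != kap]).
  exists c; first by case/andP: (c_in); lia.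
  by exists (cs1 ++ (a ++ c :: b) :: cs2) => //; apply: cells_ok_insert_inner.
have {}full : kap <= count inner (a ++ b) + (size cs1 == 0) + (size cs2 == 0).
  apply: cell_full_count => c c_in c1 ck; apply: contrapT => /negP c_new.
  by apply: full; exists c.
have [lt_Q|ge_Q] := ltnP (size (cs1 ++ (a ++ b) :: cs2)) Q; first exact: cells_ok_cut ok lt_Q full.
have size_cs : size (cs1 ++ (a ++ b) :: cs2) = Q by lia.
have [|c c_lt ok'] := cells_ok_insert_outer ok size_cs.
  have := count_letters_le (flatten (cs1 ++ (a ++ b) :: cs2)).
  have := count_inner_full ok full; rewrite size_cs; lia.
by exists c => //; exists (cs1 ++ (a ++ c :: b) :: cs2).
Qed.

End Cells.

(** * Choice of the parameters *)

Theorem theorem2 (R : realType) (m k : nat) (hk : (4 <= k)%N) (hkm : (k <= m)%N) :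
  (k %/ 2 * (m - k + 5) - 3 <= ESO R m k)%N.
Proof.
have [k_lt6|k_ge6] := ltnP k 6.
  have -> : k %/ 2 = 2 by lia.
  suff : 2 * m.-1 < ESO R m k by lia.
  apply: (@survival R m k 3 _ (three_band_word m.-1)) => //.
  - by split=> // -[|x u] [|y v].
  - by move=> w [].
  - by move=> w s w_ok s_sub ss; apply: leq_ltn_trans (three_band_chain w_ok s_sub ss) _; lia.
  - exact: three_band_step.
(* [Q] is chosen so that the bound [Q + kap - 3] on chains equals [m.-1]. *)
pose p := (k %/ 2).-1; pose kap := p.*2.-1; pose Q := m + 2 - kap.
have p2 : 2 <= p by rewrite /p; lia.
have kapE : kap.+1 = p.*2 by rewrite /kap; lia.
have kap_m : kap + 2 < m by rewrite /kap /p; lia.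
have QE : Q + kap = m + 2 by rewrite /Q; lia.
(* By [kapE] the right-hand side is [p.+1 * Q + p - 4 - 1], which suffices because [2 <= p]. *)
have bound : k %/ 2 * (m - k + 5) - 3 <= (p * Q.-1 + kap + Q - 5).+1.
  have le_Q : m - k + 5 <= Q by rewrite /Q /kap /p; lia.
  have -> : k %/ 2 = p.+1 by rewrite /p; lia.
  have : p.+1 * (m - k + 5) <= p.+1 * Q by rewrite leq_mul2l le_Q orbT.
  by case: (Q) QE => [|q] QE; rewrite ?mulSn ?mulnS /=; lia.
apply: leq_trans bound _.
apply: (@survival R m k kap.+2 _
  (fun w => exists2 cs, cells_ok p kap Q cs & flatten cs = w)).
- by rewrite /kap /p; lia.
(* The empty word is one empty cell; having no neighbours, it is exempt from the lower bound on its
   letters. *)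
- exists [:: [::]] => //; split=> //=; first by lia.
  + by move=> i; case: i => [|[|i]].
  + by move=> i; case: i => [|[|i]].
- by move=> w [cs [_ cs_ok _ _ _] <-]; apply: cells_lt cs_ok.
- move=> w s [cs ok <-] s_sub ss; have [/andP[_ le_Q] _ _ _ _] := ok.
  suff : size s + 3 <= m + 2 by lia.
  by apply: leq_trans (cells_chain p2 kapE ok s_sub ss) _; rewrite -QE leq_add2r.
move=> u v [cs ok def_uv] few.
have {}few : size (u ++ v) + 5 < p * Q.-1 + kap + Q by lia.
have [c c_lt [cs' ok' def_cs']] := cells_step p2 kapE ok def_uv few.
by exists c => //; exists cs'.
Qed.
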